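(* Let $H$ be a complex separable Hilbert space and let $\{x_k\}_{k=1}^\infty$ and $\{y_k\}_{k=1}^\infty$ be sequences in $H$ such that for every $u\in H$ the series $$Tu=\sum_{k=1}^\infty \langle u, y_k\rangle x_k$$ converges unconditionally in $H$. Then there exists a sequence of nonzero complex numbers $\{\alpha_k\}_{k=1}^\infty$ such that both $\{\alpha_k x_k\}_{k=1}^\infty$ and $\{\overline{\alpha}_k^{-1}y_k\}_{k=1}^\infty$ are Bessel.
   Context: The inner product $\langle\cdot,\cdot\rangle$ is linear in the first argument and conjugate-linear in the second. A sequence $\{z_k\}_{k=1}^\infty$ in $H$ is called $C$-Bessel (for a constant $C>0$) if $\sum_{k=1}^\infty |\langle u, z_k\rangle|^2\leqslant C\|u\|^2$ for every $u\in H$; it is called Bessel if it is $C$-Bessel for some $C>0$. *)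

(* Defs.v *)
From HB Require Import structures.
From mathcomp Require Import all_boot all_order all_algebra sesquilinear.
From mathcomp Require Export complex.
From mathcomp Require Import all_classical all_reals all_analysis.
Import Order.TTheory GRing.Theory Num.Theory.
Import numFieldNormedType.Exports.

Set Implicit Arguments.
Unset Strict Implicit.
Unset Printing Implicit Defensive.

Local Open Scope classical_set_scope.
Local Open Scope ring_scope.

Definition separable (T : topologicalType) : Prop :=
  exists2 D : set T, countable D & dense D.

(* All rearrangements converge; that their sums then agree is a consequence. *)
Definition unconditionally_cvg (K : numFieldType) (V : normedModType K)
    (v : nat -> V) : Prop :=
  forall s : nat -> nat, bijective s -> cvgn (series (v \o s)).

Section Bessel.
Context (R : realType) (H : normedModType R[i]).
Implicit Types (dot : H -> H -> R[i]) (z : nat -> H).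

(* Norms over R[i] are R[i]-valued; they are real, so Re loses nothing.
   The sum is taken in \bar R, so that the inequality also says it is finite. *)
Definition Bessel_with dot (C : R) z : Prop :=
  forall u : H,
    (\sum_(0 <= k <oo) ((complex.Re `|dot u (z k)|) ^+ 2)%:E
       <= (C * (complex.Re `|u|) ^+ 2)%:E)%E.

Definition Bessel dot z : Prop := exists2 C : R, 0 < C & Bessel_with dot C z.

End Bessel.

(* Main.v *)
Require Import Defs.
From HB Require Import structures.
From mathcomp Require Import all_boot all_order all_algebra sesquilinear.
From mathcomp Require Import all_classical all_reals all_analysis.
From mathcomp Require Import ring lra zify.
Import Order.TTheory GRing.Theory Num.Theory.
Import numFieldNormedType.Exports.
Set Implicit Arguments.
Unset Strict Implicit.
Unset Printing Implicit Defensive.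

Local Open Scope classical_set_scope.
Local Open Scope ring_scope.

(** Unconditional convergence and uniform boundedness give a constant [C] with
    [sum_k |<u, y_k>| |<x_k, v>| <= C |u| |v|].  Evaluating this at random signed
    sums [u = sum_j +-v_j] and [v = sum_i +-u_i], Khintchine's inequality yields
    [sum_k (sum_i |<u_i, x_k>|^2)^(1/2) (sum_j |<v_j, y_k>|^2)^(1/2)
       <= 2 C (sum_i |u_i|^2 + sum_j |v_j|^2)].
    As [inf_t (a e^t + b e^-t) = 2 (a b)^(1/2)], this says that for every finite
    convex combination of the convex functions
    [t |-> sum_(k<n) (|<u, x_k>|^2 e^(t_k) + |<v, y_k>|^2 e^(-t_k))
             - (4 C + 2) (|u|^2 + |v|^2)]
    some [t] makes the combination nonpositive.  A minimax theorem on a compact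
    box gives one [t] that makes all of them nonpositive, and
    [alpha_k = e^(t_k / 2)] works. *)

(** * A minimax theorem *)

Section Minimax.
Context (R : realType) (T : topologicalType) (I : choiceType).
Variables (K : set T) (F : I -> T -> R).
Hypothesis K_compact : compact K.
Hypothesis F_continuous : forall i, continuous (F i).
Hypothesis F_convexlike : forall w w' (s : R), K w -> K w' -> 0 <= s <= 1 ->
  exists2 z, K z & forall i, F i z <= (1 - s) * F i w + s * F i w'.
Hypothesis F_combination : forall (r : seq I) (p : I -> R),
  (forall i, 0 <= p i) -> exists2 z, K z & \sum_(i <- r) p i * F i z <= 0.

Lemma minimax_finite (r : seq I) :
  exists2 z, K z & forall i, i \in r -> F i z <= 0.
Proof.
(* At a minimiser [w] of [Phi], moving towards the point [z] given by the weights
   [p i = max 0 (F i w)] would decrease [Phi] unless all [p i] vanish. *)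
pose Phi z := \sum_(i <- r) Num.max 0 (F i z) ^+ 2.
have Phi_continuous : continuous Phi.
  apply: (@continuous_big _ _ _ _ _ _ _ r (fun i z => Num.max 0 (F i z) ^+ 2)).
    exact: add_continuous.
  move=> i _ z; apply: (@continuous_comp _ _ _ (fun z => Num.max 0 (F i z))
    (fun a => a ^+ 2)); last exact: exprn_continuous.
  by apply: (@continuous_max _ _ (fun=> 0) (F i));
    [exact: cst_continuous|exact: F_continuous].
have [z0 Kz0 _] := @F_combination [::] (fun=> 0) (fun=> lexx 0).
have [w /[!inE] Kw Phi_min] := compact_EVT_min (ex_intro _ z0 Kz0) K_compact
  (continuous_subspaceT Phi_continuous).
pose p i := Num.max 0 (F i w).
have p_ge0 i : 0 <= p i by rewrite le_max lexx.
have [z Kz z_le0] := @F_combination r p p_ge0.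
pose P := \sum_(i <- r) p i ^+ 2.
pose D := \sum_(i <- r) F i z ^+ 2.
have P_ge0 : 0 <= P by apply: sumr_ge0 => i _; exact: sqr_ge0.
have D_ge0 : 0 <= D by apply: sumr_ge0 => i _; exact: sqr_ge0.
have [P0|P_neq0] := eqVneq P 0.
  exists w => // i ir; move/eqP: P0.
  rewrite psumr_eq0 => [/allP/(_ i ir)/=|j _]; last exact: sqr_ge0.
  by rewrite sqrf_eq0 /p => /eqP <-; rewrite le_max lexx orbT.
have P_gt0 : 0 < P by rewrite lt_neqAle eq_sym P_neq0.
have PD_gt0 : 0 < P + D by rewrite ltr_pwDl.
(* This [s] minimises [(1 - s)^2 P + s^2 D], with minimum [(1 - s) P < P]. The cross term is
   nonpositive by the choice of [z], so minimality of [Phi w = P] is contradicted. *)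
pose s := P / (P + D).
have s_gt0 : 0 < s by rewrite divr_gt0.
have s_le1 : s <= 1 by rewrite ler_pdivrMr// mul1r lerDl.
have [v Kv v_le] := @F_convexlike w z s Kw Kz ltac:(by rewrite ltW//= s_le1).
have : Phi v <= \sum_(i <- r) ((1 - s) * p i + s * F i z) ^+ 2.
  apply: ler_sum => i _; have [|F_gt0] := leP (F i v) 0.
    by move=> _; rewrite expr0n /= sqr_ge0.
  rewrite lerXn2r ?nnegrE// ?(ltW F_gt0)//.
    rewrite (le_trans (ltW F_gt0))// (le_trans (v_le i))// lerD2r.
    by rewrite ler_wpM2l ?subr_ge0// le_max lexx orbT.
  by rewrite (le_trans (v_le i))// lerD2r ler_wpM2l ?subr_ge0// le_max lexx orbT.
rewrite (_ : \sum_(i <- r) _ = (1 - s) ^+ 2 * P + s ^+ 2 * D +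
    2 * s * (1 - s) * \sum_(i <- r) p i * F i z); last first.
  rewrite /P /D !mulr_sumr -!big_split /=; apply: eq_bigr => i _; ring.
move=> Phi_v; have := Phi_min v ltac:(by rewrite inE).
have sPD : s * (P + D) = P by rewrite /s divfK// gt_eqF.
have PhiE : Phi w = P by [].
have s1_ge0 : 0 <= 2 * s * (1 - s) by rewrite mulr_ge0 ?subr_ge0// mulr_ge0// ltW.
have cross_le0 := mulr_ge0_le0 s1_ge0 z_le0.
have sP_gt0 := mulr_gt0 s_gt0 P_gt0.
rewrite PhiE; nra.
Qed.

(** The sets where [F i] is nonpositive are closed in the compact [K], and finitely many of them
    always meet by [minimax_finite]; hence all of them meet. *)
Lemma minimax : exists2 z, K z & forall i, F i z <= 0.
Proof.
pose S i : set T := K `&` F i @^-1` [set a | a <= 0].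
have SI : closed_fam_of K setT S.
  exists (fun i => F i @^-1` [set a | a <= 0]) => // i _.
  by move: (@F_continuous i) => /continuous_closedP; apply; exact: closed_le.
have fI : finI setT S.
  move=> D _; have [z Kz Fz] := minimax_finite (finmap.enum_fset D).
  by exists z => i iD; split => //; exact: Fz.
(* [z0] is the base point for the finite intersection form of compactness, and the answer when [I]
   is empty. *)
have [z0 Kz0 _] := @F_combination [::] (fun=> 0) (fun=> lexx 0).
pose pT : ptopologicalType := HB.pack T (isPointed.Build T z0).
have := K_compact; rewrite -[compact K]/(@compact pT K) compact_In0.
move=> /(_ _ _ _ SI fI)[z Sz].
have [[i _]|I0] := pselect (exists i : I, True).
  by exists z => [|j]; [have [] := Sz i Logic.I|have [] := Sz j Logic.I].
by exists z0 => // i; case: I0; exists i.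
Qed.

End Minimax.

(** * Exponential weights *)

(** For positive [a] and [b] the minimiser is [ln (b / a) / 2], where both terms equal [sqrt (a b)].
    If it falls outside [[- T, T]], the nearest endpoint makes one term at most [sqrt (a b)], and
    the error term absorbs the other. Vanishing coefficients fall under the endpoint cases. *)
Lemma clamped_balance (R : realType) (a b T : R) : 0 <= a -> 0 <= b -> 0 <= T ->
  exists2 t, - T <= t <= T &
    a * expR t + b * expR (- t) <=
      2 * Num.sqrt (a * b) + (a + b) * expR (- T).
Proof.
move=> a_ge0 b_ge0 T_ge0.
have eT : expR T * expR (- T) = 1 by rewrite -expRD subrr expR0.
have eT_gt0 := expR_gt0 T; have eNT_gt0 := expR_gt0 (- T).
have ab_ge0 := mulr_ge0 a_ge0 b_ge0.
have s_ge0 := sqrtr_ge0 (a * b); have s2 := sqr_sqrtr ab_ge0.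
(* Used with [x, y] equal to [a, b] at the endpoint [T] and to [b, a] at [- T]. Multiplying the last
   hypothesis by [x e^T] gives [(x e^T)^2 <= x y]. *)
have clamp x y : 0 <= x -> 0 <= y -> x * y = a * b ->
    x * expR T <= y * expR (- T) ->
    x * expR T + y * expR (- T) <=
      2 * Num.sqrt (a * b) + (x + y) * expR (- T).
  move=> x_ge0 y_ge0 xy xTy.
  suff : x * expR T <= Num.sqrt (a * b) by have := mulr_ge0 x_ge0 (ltW eNT_gt0); lra.
  rewrite -(@ler_pXn2r _ 2) ?nnegrE ?mulr_ge0 ?(ltW eT_gt0)// s2 -xy.
  have := ler_wpM2l (mulr_ge0 x_ge0 (ltW eT_gt0)) xTy; nra.
have [aTb|bTa] := leP (a * expR T) (b * expR (- T)).
  by exists T; [lra|exact: clamp].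
have [bTa'|aTb'] := leP (b * expR T) (a * expR (- T)).
  exists (- T); first lra.
  by rewrite opprK addrC [a + b]addrC clamp// mulrC.
have a_gt0 : 0 < a by nra.
have b_gt0 : 0 < b by nra.
pose t := (ln b - ln a) / 2.
have et2 : expR t ^+ 2 * a = b.
  rewrite -expRM_natl /t [2 * _]mulrC divfK// expRD expRN !lnK ?posrE//.
  by rewrite divfK// gt_eqF.
have et := expR_gt0 t.
have ett : expR t * expR (- t) = 1 by rewrite -expRD subrr expR0.
exists t.
  rewrite -[t <= T]ler_expR -[- T <= t]ler_expR; apply/andP; split.
    rewrite -(@ler_pXn2r _ 2) ?nnegrE ?expR_ge0//; nra.
  rewrite -(@ler_pXn2r _ 2) ?nnegrE ?expR_ge0//; nra.
suff -> : Num.sqrt (a * b) = a * expR t.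
  have : b * expR (- t) = a * expR t by rewrite -et2; nra.
  have := mulr_ge0 (addr_ge0 a_ge0 b_ge0) (ltW eNT_gt0); lra.
rewrite -et2 (_ : a * _ = (a * expR t) ^+ 2); last ring.
by rewrite sqrtr_sqr ger0_norm// mulr_ge0// ltW.
Qed.

Lemma expR_convex (R : realType) (s x y : R) : 0 <= s <= 1 ->
  expR ((1 - s) * x + s * y) <= (1 - s) * expR x + s * expR y.
Proof.
move=> /andP[s_ge0 s_le1]; rewrite addrC [leRHS]addrC.
exact: (convex_expR (Itv01 s_ge0 s_le1) y x).
Qed.

Lemma continuous_coordinate_expR (R : realType) (a b : R) (k : nat) :
  continuous (fun t : prod_topology (fun _ : nat => R) =>
    a * expR (t k) + b * expR (- t k)).
Proof.
pose g (u : R) := a * expR u + b * expR (- u).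
have g_continuous : continuous g.
  move=> u; apply: cvgD; apply: cvgM; do ?exact: cvg_cst.
    exact: continuous_expR.
  apply: (@continuous_comp _ _ _ (fun u : R => - u)); last exact: continuous_expR.
  exact: oppr_continuous.
move=> t; apply: (@continuous_comp _ _ _
  (fun t : prod_topology (fun _ : nat => R) => t k) g).
  exact: (@proj_continuous _ (fun=> R) k).
exact: g_continuous.
Qed.

Lemma continuous_weighted_expR (R : realType) (a b : nat -> R) (n : nat) (c : R) :
  continuous (fun t : prod_topology (fun _ : nat => R) =>
    \sum_(k < n) (a k * expR (t k) + b k * expR (- t k)) - c).
Proof.
pose S (t : prod_topology (fun _ : nat => R)) : R :=
  \sum_(k < n) (a k * expR (t k) + b k * expR (- t k)).
have S_continuous : continuous S.
  apply: (@continuous_big _ _ _ _ _ _ _ _ (fun (k : 'I_n)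
    (t : prod_topology (fun _ : nat => R)) =>
      a k * expR (t k) + b k * expR (- t k))).
    exact: add_continuous.
  move=> k _.
  exact: continuous_coordinate_expR.
move=> t; apply: (@continuous_comp _ _ _ S (fun u : R => u - c)).
  exact: S_continuous.
by apply: cvgB; [exact: cvg_id|exact: cvg_cst].
Qed.

(** Each index [i] has its own length [N i], so that one [t] can serve all truncations of an
    infinite sum. The bounds [A] and [B] do not depend on [i], which lets the compact box be fixed
    before the convex combination is known. *)
Lemma balanced_weights (R : realType) (I : choiceType) (N : I -> nat)
    (a b : I -> nat -> R) (c : I -> R) (A B : nat -> R) (C : R) :
  (forall i k, 0 <= a i k <= A k * c i) ->
  (forall i k, 0 <= b i k <= B k * c i) ->
  (forall k, 0 <= A k) -> (forall k, 0 <= B k) -> (forall i, 0 <= c i) ->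
  (forall (r : seq I) (p : I -> R) n, (forall i, 0 <= p i) ->
    \sum_(k < n) Num.sqrt ((\sum_(i <- r) p i * a i k) *
                           (\sum_(i <- r) p i * b i k)) <=
      C * \sum_(i <- r) p i * c i) ->
  exists t : nat -> R, forall i,
    \sum_(k < N i) (a i k * expR (t k) + b i k * expR (- t k)) <=
      (2 * C + 2) * c i.
Proof.
move=> aA bB A_ge0 B_ge0 c_ge0 abC.
have a_ge0 i k : 0 <= a i k by have /andP[] := aA i k.
have b_ge0 i k : 0 <= b i k by have /andP[] := bB i k.
(* This box is so large that clamping [t k] to it costs at most [2^-k * c]. *)
pose T k := ln (2 ^+ k * (1 + A k + B k)).
have AB_gt0 k : 0 < 1 + A k + B k by have := A_ge0 k; have := B_ge0 k; lra.
have eT k : expR (- T k) = 2^-1 ^+ k / (1 + A k + B k).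
  by rewrite expRN lnK ?posrE ?mulr_gt0 ?exprn_gt0// invfM exprVn.
have T_ge0 k : 0 <= T k.
  apply: ln_ge0; rewrite mulr_ege1 ?exprn_ege1 ?ler1n//.
  by have := A_ge0 k; have := B_ge0 k; lra.
pose K : set (prod_topology (fun _ : nat => R)) :=
  [set t | forall k, `[- T k, T k]%classic (t k)].
have K_compact : compact K.
  apply: (@tychonoff nat (fun=> R) (fun k => `[- T k, T k]%classic)) => k.
  exact: segment_compact.
pose F i (t : prod_topology (fun _ : nat => R)) :=
  \sum_(k < N i) (a i k * expR (t k) + b i k * expR (- t k)) -
  (2 * C + 2) * c i.
have F_continuous i : continuous (F i).
  exact: continuous_weighted_expR.
have F_convex w w' (s : R) : K w -> K w' -> 0 <= s <= 1 ->
    exists2 z, K z & forall i, F i z <= (1 - s) * F i w + s * F i w'.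
  move=> Kw Kw' s01; have /andP[s_ge0 s_le1] := s01.
  exists (fun k => (1 - s) * w k + s * w' k) => [k /=|i].
    have := Kw k; have := Kw' k; rewrite /= !in_itv /= => /andP[? ?] /andP[? ?].
    by apply/andP; split; nra.
  rewrite /F [leRHS](_ : _ = \sum_(k < N i)
      ((1 - s) * (a i k * expR (w k) + b i k * expR (- w k)) +
       s * (a i k * expR (w' k) + b i k * expR (- w' k))) - (2 * C + 2) * c i);
      last first.
    by rewrite [X in _ = X - _]big_split /= -!mulr_sumr; ring.
  rewrite lerD2r; apply: ler_sum => k _.
  have := ler_wpM2l (a_ge0 i k) (@expR_convex _ _ (w k) (w' k) s01).
  have := ler_wpM2l (b_ge0 i k) (@expR_convex _ _ (- w k) (- w' k) s01).
  rewrite (_ : - ((1 - s) * w k + s * w' k) = (1 - s) * - w k + s * - w' k);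
    last ring.
  lra.
have F_combination (r : seq I) (p : I -> R) : (forall i, 0 <= p i) ->
    exists2 z, K z & \sum_(i <- r) p i * F i z <= 0.
  move=> p_ge0.
  pose a' k := \sum_(i <- r) p i * a i k.
  pose b' k := \sum_(i <- r) p i * b i k.
  pose c' := \sum_(i <- r) p i * c i.
  have a'_ge0 k : 0 <= a' k by apply: sumr_ge0 => i _; exact: mulr_ge0.
  have b'_ge0 k : 0 <= b' k by apply: sumr_ge0 => i _; exact: mulr_ge0.
  have c'_ge0 : 0 <= c' by apply: sumr_ge0 => i _; exact: mulr_ge0.
  have a'A k : a' k <= A k * c'.
    rewrite mulr_sumr; apply: ler_sum => i _.
    by rewrite mulrCA ler_wpM2l//; have /andP[] := aA i k.
  have b'B k : b' k <= B k * c'.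
    rewrite mulr_sumr; apply: ler_sum => i _.
    by rewrite mulrCA ler_wpM2l//; have /andP[] := bB i k.
  (* For a fixed combination the coordinates decouple: each [z k] balances the combined coefficients
     [a' k] and [b' k] on its own. *)
  have /choice[z z_prop] k : exists t, - T k <= t <= T k /\
      a' k * expR t + b' k * expR (- t) <=
        2 * Num.sqrt (a' k * b' k) + 2^-1 ^+ k * c'.
    have [t tT tab] := clamped_balance (a'_ge0 k) (b'_ge0 k) (T_ge0 k).
    exists t; split => //; apply: (le_trans tab); rewrite lerD2l eT.
    rewrite mulrCA ler_wpM2l ?exprn_ge0// ler_pdivrMr//.
    have := a'A k; have := b'B k; nra.
  exists z => [k /=|]; first by rewrite in_itv /=; have [] := z_prop k.
  (* The sums are extended to a common length [n], which can only increase them, so that the two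
     summations can be exchanged. *)
  pose n := \max_(i <- r) N i.
  have Nn i : i \in r -> (N i <= n)%N by move=> ir; exact: leq_bigmax_seq.
  pose G i k := a i k * expR (z k) + b i k * expR (- z k).
  have G_ge0 i k : 0 <= G i k by rewrite addr_ge0// mulr_ge0// expR_ge0.
  have : \sum_(i <- r) p i * \sum_(k < N i) G i k <= (2 * C + 2) * c'.
    apply: (@le_trans _ _ (\sum_(i <- r) p i * \sum_(k < n) G i k)).
      rewrite big_seq [leRHS]big_seq; apply: ler_sum => i /Nn Nin.
      rewrite ler_wpM2l// -[leLHS](big_mkord xpredT (G i)).
      rewrite -[leRHS](big_mkord xpredT (G i)) (big_cat_nat _ Nin)//= lerDl.
      exact: sumr_ge0.
    under eq_bigr do rewrite mulr_sumr.
    rewrite exchange_big /=.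
    apply: (@le_trans _ _ (\sum_(k < n)
        (2 * Num.sqrt (a' k * b' k) + 2^-1 ^+ k * c'))).
      apply: ler_sum => k _; have [_] := z_prop k; apply: le_trans.
      rewrite /a' /b' !mulr_suml -big_split /= le_eqVlt; apply/orP; left.
      apply/eqP; apply: eq_bigr => i _; rewrite /G; ring.
    rewrite big_split /= -mulr_sumr -mulr_suml.
    rewrite (_ : (2 * C + 2) * c' = 2 * (C * c') + 2 * c'); last ring.
    apply: lerD.
      by rewrite ler_wpM2l// abC.
    rewrite ler_wpM2r//.
    (* The clamping errors form a geometric series with sum below 2, the source of the summand 2 in
       [2 * C + 2]. *)
    have -> : \sum_(k < n) 2^-1 ^+ k = 2 - 2 * 2^-1 ^+ n :> R.
      elim: n {Nn} => [|m IH]; first by rewrite big_ord0 expr0; lra.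
      by rewrite big_ord_recr /= IH exprS; lra.
    by rewrite gerBl mulr_ge0// exprn_ge0.
  under [X in _ -> X <= 0]eq_bigr do rewrite mulrBr mulrCA.
  by rewrite sumrB -mulr_sumr subr_le0.
have [t _ tF] := @minimax R _ I K F K_compact F_continuous F_convex F_combination.
by exists t => i; have := tF i; rewrite /F subr_le0.
Qed.

(** * Rademacher sums *)

Section Rademacher.
Context (R : realType) (V : zmodType).
Implicit Types (l : seq V) (f g q : V -> R).

(* The expectation of [f] at the random signed sum of the entries of [l]. *)
Fixpoint rademacher l f : R :=
  if l is a :: l' then rademacher l' (fun s => (f (s + a) + f (s - a)) / 2)
  else f 0.

Lemma rademacher_le l f g :
  (forall s, f s <= g s) -> rademacher l f <= rademacher l g.
Proof.
elim: l f g => [|a l IH] f g fg /=; first exact: fg.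
by apply: IH => s; rewrite ler_pM2r ?invr_gt0// lerD.
Qed.

Lemma eq_rademacher l f g : f =1 g -> rademacher l f = rademacher l g.
Proof. by move=> fg; apply/eqP; rewrite eq_le !rademacher_le// => s; rewrite fg. Qed.

Lemma rademacher_cst l (c : R) : rademacher l (fun=> c) = c.
Proof.
elim: l => [//|a l IH] /=; rewrite -[RHS]IH; apply: eq_rademacher => s; lra.
Qed.

Lemma rademacherD l f g :
  rademacher l (fun s => f s + g s) = rademacher l f + rademacher l g.
Proof.
elim: l f g => [//|a l IH] f g /=; rewrite -IH; apply: eq_rademacher => s; lra.
Qed.

Lemma rademacherZ l (c : R) f : rademacher l (fun s => c * f s) = c * rademacher l f.
Proof.
elim: l f => [//|a l IH] f /=; rewrite -IH; apply: eq_rademacher => s; lra.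
Qed.

Lemma rademacher_sum l n (f : 'I_n -> V -> R) :
  rademacher l (fun s => \sum_(k < n) f k s) = \sum_(k < n) rademacher l (f k).
Proof.
elim: n f => [|n IH] f.
  rewrite big_ord0 -[RHS](rademacher_cst l).
  by apply: eq_rademacher => s; rewrite big_ord0.
rewrite big_ord_recr /= -IH -rademacherD; apply: eq_rademacher => s.
by rewrite big_ord_recr.
Qed.

(** Averaging over the sign of an entry removes the cross terms: the signed entries are orthogonal
    in mean. *)
Lemma rademacher_parallelogram l q : q 0 = 0 ->
  (forall s a, q (s + a) + q (s - a) = 2 * (q s + q a)) ->
  rademacher l q = \sum_(a <- l) q a.
Proof.
move=> q0 qD; elim: l => [|a l IH] /=; first by rewrite big_nil.
rewrite big_cons -IH -[q a in RHS](rademacher_cst l) -rademacherD.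
apply: eq_rademacher => s; rewrite qD; lra.
Qed.

(** * Khintchine's inequality *)

Section Khintchine.
Variables (q : V -> R) (b : V -> V -> R).
Hypothesis q_ge0 : forall s, 0 <= q s.
Hypothesis q0 : q 0 = 0.
Hypothesis qD : forall s a, q (s + a) = q s + q a + 2 * b s a.
Hypothesis qB : forall s a, q (s - a) = q s + q a - 2 * b s a.
Hypothesis b_le : forall s a, b s a ^+ 2 <= q s * q a.

Lemma rademacher_quadratic l : rademacher l q = \sum_(a <- l) q a.
Proof. by apply: rademacher_parallelogram => // s a; rewrite qD qB; lra. Qed.

(** Averaging over the sign of [a] gives [(q s + q a)^2 + 4 (b s a)^2], which the Cauchy-Schwarz
    hypothesis [b_le] bounds by [q s^2 + 6 q a q s + q a^2]. Induction then preserves the constant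
    3. *)
Lemma rademacher_fourth_moment l :
  rademacher l (fun s => q s ^+ 2) <= 3 * (\sum_(a <- l) q a) ^+ 2.
Proof.
elim: l => [|a l IH] /=; first by rewrite big_nil q0 expr0n mulr0.
apply: (@le_trans _ _ (rademacher l (fun s =>
    q s ^+ 2 + (6 * q a * q s + q a ^+ 2)))).
  apply: rademacher_le => s; rewrite qD qB; have := b_le s a; nra.
rewrite !rademacherD rademacherZ rademacher_cst rademacher_quadratic big_cons.
have := q_ge0 a; nra.
Qed.

(** The square root is minorised by a polynomial in [q s] whose mean is under control: the second
    moment contributes [3/4 m] and the fourth costs at most [m / 4]. What remains is [m / 2], hence
    the factor 2. *)
Lemma khintchine l :
  Num.sqrt (\sum_(a <- l) q a) <= 2 * rademacher l (fun s => Num.sqrt (q s)).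
Proof.
set M := \sum_(a <- l) q a; set m := Num.sqrt M.
have M_ge0 : 0 <= M by apply: sumr_ge0 => a _; exact: q_ge0.
have mM : m ^+ 2 = M by rewrite sqr_sqrtr.
have [M0|M_neq0] := eqVneq M 0.
  rewrite /m M0 sqrtr0 mulr_ge0// -[leLHS](rademacher_cst l).
  by apply: rademacher_le => s; exact: sqrtr_ge0.
have m_gt0 : 0 < m by rewrite sqrtr_gt0 lt_neqAle eq_sym M_neq0.
have fourth := rademacher_fourth_moment l; rewrite -/M -mM in fourth.
(* For v >= 0, v >= 3/4 v^2 - v^4/12; apply this to v = sqrt (q s) / m. *)
have pointwise s : 3 / 4 / m * q s + - (12 * m ^+ 3)^-1 * q s ^+ 2 <= Num.sqrt (q s).
  set t := Num.sqrt (q s); have t_ge0 : 0 <= t := sqrtr_ge0 _.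
  have -> : q s = t ^+ 2 by rewrite sqr_sqrtr.
  pose v := t / m; have v_ge0 : 0 <= v by rewrite divr_ge0// ltW.
  have tE : t = m * v by rewrite mulrC divfK// gt_eqF.
  suff : 3 / 4 * v ^+ 2 - v ^+ 4 / 12 <= v.
    rewrite -(ler_pM2l m_gt0) -tE; apply: le_trans.
    rewrite tE le_eqVlt; apply/orP; left; apply/eqP; field.
    by rewrite gt_eqF.
  (* Twelve times the gap is [v (v^3 - 9 v + 12)], and the cubic exceeds [(v - 7/4)^2 (v + 7/2)] by
     [3/16 v + 41/32]. The value [7/4] approximates its minimiser [sqrt 3]. *)
  have : 0 <= v * ((v - 7 / 4) ^+ 2 * (v + 7 / 2)).
    by apply: mulr_ge0 => //; apply: mulr_ge0; [exact: sqr_ge0|lra].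
  nra.
have := rademacher_le l pointwise.
rewrite rademacherD !rademacherZ rademacher_quadratic -/M -mM => h.
have m3_gt0 : 0 < (12 * m ^+ 3)^-1 by rewrite invr_gt0 mulr_gt0// exprn_gt0.
have := ler_wpM2l (ltW m3_gt0) fourth.
have -> : (12 * m ^+ 3)^-1 * (3 * (m ^+ 2) ^+ 2) = m / 4.
  by field; rewrite gt_eqF.
have e : 3 / 4 / m * m ^+ 2 = 3 / 4 * m by field; rewrite gt_eqF.
rewrite e in h; lra.
Qed.

End Khintchine.
End Rademacher.

(** * Complex inner products *)

Section RealNorm.
Context (R : realType) (V : normedModType R[i]).
Implicit Types (u v : V) (a : R[i]).

Definition rnorm u : R := complex.Re `|u|.

Lemma rnormE u : `|u| = (rnorm u)%:C%C.
Proof. by rewrite /rnorm RRe_real// ger0_real. Qed.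

Lemma rnorm_ge0 u : 0 <= rnorm u.
Proof. by rewrite -ler0c -rnormE. Qed.

Lemma rnormD u v : rnorm (u + v) <= rnorm u + rnorm v.
Proof. by rewrite -lecR rmorphD /= -!rnormE ler_normD. Qed.

Lemma rnormN u : rnorm (- u) = rnorm u.
Proof. by rewrite /rnorm normrN. Qed.

Lemma rnormB u v : rnorm (u - v) = rnorm (v - u).
Proof. by rewrite -rnormN opprB. Qed.

Lemma rnorm0 : rnorm 0 = 0.
Proof. by rewrite /rnorm normr0. Qed.

Lemma rnorm_sum (I : Type) (r : seq I) (P : pred I) (f : I -> V) :
  rnorm (\sum_(i <- r | P i) f i) <= \sum_(i <- r | P i) rnorm (f i).
Proof.
elim/big_rec2: _ => [|i y x _ IH]; first by rewrite rnorm0.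
by rewrite (le_trans (rnormD _ _))// lerD2l.
Qed.

End RealNorm.

Section Modulus.
Context (R : realType).
Implicit Types (z w : R[i]) (c : R).

Definition modulus z : R := complex.Re `|z|.

Lemma modulusE z : `|z| = (modulus z)%:C%C.
Proof. by rewrite /modulus RRe_real// ger0_real. Qed.

Lemma modulus_ge0 z : 0 <= modulus z.
Proof. by rewrite -ler0c -modulusE. Qed.

Lemma modulus0 : modulus 0 = 0.
Proof. by rewrite /modulus normr0. Qed.

Lemma modulusD z w : modulus (z + w) <= modulus z + modulus w.
Proof. by rewrite -lecR rmorphD /= -!modulusE ler_normD. Qed.

Lemma modulusM z w : modulus (z * w) = modulus z * modulus w.
Proof. by apply/complexI; rewrite -modulusE normrM !modulusE rmorphM. Qed.

Lemma modulusJ z : modulus (Num.conj z) = modulus z.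
Proof. by rewrite /modulus norm_conjC. Qed.

Lemma modulusV z : modulus z^-1 = (modulus z)^-1.
Proof. by apply/complexI; rewrite -modulusE normfV modulusE fmorphV. Qed.

Lemma modulusN z : modulus (- z) = modulus z.
Proof. by rewrite /modulus normrN. Qed.

Lemma modulus_real c : 0 <= c -> modulus c%:C%C = c.
Proof. by move=> c0; rewrite /modulus ger0_norm// ler0c. Qed.

Lemma sqr_modulus z : modulus z ^+ 2 = complex.Re z ^+ 2 + complex.Im z ^+ 2.
Proof.
apply/complexI; rewrite rmorphXn /= -modulusE -add_Re2_Im2.
by [].
Qed.

Lemma ler_norm_Re_modulus z : `|complex.Re z| <= modulus z.
Proof.
rewrite -(@ler_pXn2r _ 2) ?nnegrE ?modulus_ge0// sqr_modulus.
by rewrite real_normK ?num_real// lerDl sqr_ge0.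
Qed.

Lemma ler_norm_Im_modulus z : `|complex.Im z| <= modulus z.
Proof.
rewrite -(@ler_pXn2r _ 2) ?nnegrE ?modulus_ge0// sqr_modulus.
by rewrite real_normK ?num_real// lerDr sqr_ge0.
Qed.

Lemma modulus_le_ReIm z :
  modulus z <= `|complex.Re z| + `|complex.Im z|.
Proof.
rewrite -(@ler_pXn2r _ 2) ?nnegrE ?modulus_ge0 ?addr_ge0// sqr_modulus.
rewrite sqrrD !real_normK ?num_real// lerD2r lerDl.
by rewrite mulrn_wge0// mulr_ge0.
Qed.

End Modulus.

Lemma rnormZ (R : realType) (V : normedModType R[i]) (a : R[i]) (u : V) :
  rnorm (a *: u) = modulus a * rnorm u.
Proof. by apply/complexI; rewrite -rnormE normrZ rnormE modulusE rmorphM. Qed.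

Section Dot.
Context (R : realType) (H : normedModType R[i]).
Context (dot : {dot H for (@Num.conj R[i])}).
Hypothesis dot_norm : forall u : H, dot u u = `|u| ^+ 2.
Implicit Types (u v x : H) (l : seq H).

Lemma dotC u v : dot u v = Num.conj (dot v u).
Proof. by rewrite hermC expr0 mul1r. Qed.

Lemma modulus_dotC u v : modulus (dot u v) = modulus (dot v u).
Proof. by rewrite dotC modulusJ. Qed.

Lemma dot_rnorm u : dot u u = (rnorm u ^+ 2)%:C%C.
Proof. by rewrite dot_norm rnormE rmorphXn. Qed.

Lemma sqr_rnormD u v :
  rnorm (u + v) ^+ 2 = rnorm u ^+ 2 + rnorm v ^+ 2 + 2 * complex.Re (dot u v).
Proof.
apply/complexI; rewrite -dot_rnorm dnormD !dot_rnorm !rmorphD /= addcJ.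
by rewrite [(2 * _)%:C%C]rmorphM /= rmorph_nat.
Qed.

Lemma sqr_rnormB u v :
  rnorm (u - v) ^+ 2 = rnorm u ^+ 2 + rnorm v ^+ 2 - 2 * complex.Re (dot u v).
Proof. by rewrite sqr_rnormD rnormN linearNr raddfN mulrN. Qed.

(** Cauchy-Schwarz: the vector [u] minus its projection [s <u, v> v] on [v] has nonnegative squared
    norm. *)
Lemma modulus_dot_le u v : modulus (dot u v) <= rnorm u * rnorm v.
Proof.
rewrite -(@ler_pXn2r _ 2) ?nnegrE ?mulr_ge0 ?modulus_ge0 ?rnorm_ge0//.
have [v0|v_neq0] := eqVneq (rnorm v) 0.
  have -> : v = 0 by apply/eqP; rewrite -normr_eq0 rnormE v0.
  by rewrite linear0r modulus0 rnorm0 mulr0.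
have v_gt0 : 0 < rnorm v by rewrite lt_neqAle eq_sym v_neq0 rnorm_ge0.
pose s := (rnorm v ^+ 2)^-1; have s_ge0 : 0 <= s by rewrite invr_ge0 sqr_ge0.
have sv : s * rnorm v ^+ 2 = 1 by rewrite mulVf// expf_neq0.
have scc (c : R[i]) : complex.Re (Num.conj (s%:C%C * c) * c) = s * modulus c ^+ 2.
  by case: c => p q; rewrite sqr_modulus /=; ring.
have := sqr_ge0 (rnorm (u - (s%:C%C * dot u v) *: v)).
rewrite sqr_rnormB linearZr_LR /= rnormZ modulusM (modulus_real s_ge0) scc.
set m := modulus _ => m_ge0.
have : 0 <= rnorm v ^+ 2 * (rnorm u ^+ 2 - s * m ^+ 2).
  by apply: mulr_ge0; [exact: sqr_ge0|nra].
nra.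
Qed.

Lemma rnorm_parallelogram u v :
  rnorm (u + v) ^+ 2 + rnorm (u - v) ^+ 2 = 2 * (rnorm u ^+ 2 + rnorm v ^+ 2).
Proof. rewrite sqr_rnormD sqr_rnormB; ring. Qed.

Lemma rademacher_rnorm l :
  rademacher l (fun s => rnorm s ^+ 2) = \sum_(a <- l) rnorm a ^+ 2.
Proof.
apply: rademacher_parallelogram; first by rewrite rnorm0 expr0n.
exact: rnorm_parallelogram.
Qed.

Lemma khintchine_dot l x :
  Num.sqrt (\sum_(a <- l) modulus (dot a x) ^+ 2) <=
  2 * rademacher l (fun s => modulus (dot s x)).
Proof.
(* [b] is the real inner product of [<s, x>] and [<a, x>] as vectors of the plane; its
   Cauchy-Schwarz bound is Lagrange's identity. *)
pose b s a := complex.Re (dot s x) * complex.Re (dot a x) +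
              complex.Im (dot s x) * complex.Im (dot a x).
have h := @khintchine R H (fun s => modulus (dot s x) ^+ 2) b.
apply: le_trans (h _ _ _ _ _ l) _.
- by move=> s; exact: sqr_ge0.
- by rewrite linear0l modulus0 expr0n.
- move=> s a; rewrite linearDl !sqr_modulus !raddfD /= /b; ring.
- move=> s a; rewrite linearBl !sqr_modulus !raddfB /= /b; ring.
- move=> s a; rewrite !sqr_modulus /b; set c := complex.Re _.
  set d := complex.Re _; set e := complex.Im _; set f := complex.Im _.
  have := sqr_ge0 (c * f - e * d); nra.
rewrite ler_pM2l//; apply: rademacher_le => s.
by rewrite sqrtr_sqr ger0_norm ?modulus_ge0.
Qed.

End Dot.

(** * Unconditional convergence and uniform boundedness *)

Section Rearrangement.
Variable F : nat -> seq nat.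
Hypothesis F_uniq : forall n, uniq (F n).
Hypothesis F_ge : forall n k, k \in F n -> (n <= k)%N.

(* The interval [n, bound n) contains [F n]; [block n] lists it starting with [F n]. *)
Let bound n := (maxn n (\max_(k <- F n) k)).+1.

Let block n := F n ++ [seq k <- iota n (bound n - n) | k \notin F n].

(** Every stage permutes an initial segment [[0, n)], with [n] its length, and the next stage
    continues with [F n]. In the limit this is a permutation of the naturals. *)
Fixpoint prefix_of_rearrangement j : seq nat :=
  if j is j'.+1 then
    prefix_of_rearrangement j' ++ block (size (prefix_of_rearrangement j'))
  else [::].
Local Notation L := prefix_of_rearrangement.

Let block_perm n : perm_eq (block n) (iota n (bound n - n)).
Proof.
have nb : (n <= bound n)%N by rewrite ltnW// ltnS leq_maxl.
apply: uniq_perm; last 1 first.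
- move=> k; rewrite mem_cat mem_filter mem_iota subnKC//.
  have [kF|//] := boolP (k \in F n); rewrite F_ge//=.
  by rewrite ltnS leq_max (@leq_bigmax_seq _ _ xpredT id)// orbT.
- rewrite cat_uniq F_uniq filter_uniq ?iota_uniq// andbT /=.
  by apply/hasPn => k; rewrite mem_filter => /andP[].
- exact: iota_uniq.
Qed.

Lemma prefix_perm j : perm_eq (L j) (iota 0 (size (L j))).
Proof.
elim: j => [//|j IH] /=; rewrite size_cat iotaD add0n.
by rewrite perm_cat// (perm_size (block_perm _)) size_iota.
Qed.

Lemma prefix_uniq j : uniq (L j).
Proof. by rewrite (perm_uniq (prefix_perm j)) iota_uniq. Qed.

Lemma prefix_size j : (j <= size (L j))%N.
Proof.
elim: j => [//|j IH] /=; rewrite size_cat -addn1 leq_add//.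
rewrite (perm_size (block_perm _)) size_iota subn_gt0.
by rewrite ltnS leq_maxl.
Qed.

Lemma prefix_prefix i j : (i <= j)%N -> exists s, L j = L i ++ s.
Proof.
elim: j => [|j IH]; first by rewrite leqn0 => /eqP->; exists [::].
rewrite leq_eqVlt => /orP[/eqP->|/IH[s Ls]]; first by exists [::]; rewrite cats0.
by exists (s ++ block (size (L j))); rewrite catA -Ls.
Qed.

(** Stage [k.+1] has at least [k.+1] entries, so the default [0] is never read. *)
Definition rearrangement k := nth 0%N (L k.+1) k.

Lemma rearrangementE k j : (k < size (L j))%N -> rearrangement k = nth 0%N (L j) k.
Proof.
move=> kj; have kk := prefix_size k.+1.
have [/prefix_prefix[s Ls]|/ltnW/prefix_prefix[s Ls]] := leqP k.+1 j.
  by rewrite Ls nth_cat kk.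
by rewrite /rearrangement Ls nth_cat kj.
Qed.

Lemma rearrangement_bijective : bijective rearrangement.
Proof.
have inj : injective rearrangement.
  move=> k l; pose m := maxn k l.
  have km : (k < size (L m.+1))%N.
    by rewrite (leq_trans _ (prefix_size _))// ltnS leq_maxl.
  have lm : (l < size (L m.+1))%N.
    by rewrite (leq_trans _ (prefix_size _))// ltnS leq_maxr.
  rewrite (rearrangementE km) (rearrangementE lm) => /eqP.
  by rewrite nth_uniq ?prefix_uniq// => /eqP.
pose g n := index n (L n.+1).
have gK : cancel g rearrangement.
  move=> n; have nL : n \in L n.+1.
    by rewrite (perm_mem (prefix_perm _)) mem_iota (leq_trans _ (prefix_size _)).
  by rewrite (@rearrangementE _ n.+1) ?index_mem// nth_index.
by exists g => // k; apply: inj; rewrite gK.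
Qed.

Lemma map_rearrangement j n : (n <= size (L j))%N ->
  [seq rearrangement k | k <- iota 0 n] = take n (L j).
Proof.
move=> nj; apply: (@eq_from_nth _ 0%N).
  by rewrite size_map size_iota size_takel.
move=> i; rewrite size_map size_iota => i_n.
rewrite (nth_map 0%N) ?size_iota// nth_iota// nth_take//.
by rewrite -rearrangementE// (leq_trans i_n).
Qed.

(** Consequently two partial sums of the rearranged series differ by exactly the sum over one set
    [F n]. *)
Lemma rearrangement_block j :
  [seq rearrangement k | k <- iota 0 (size (L j) + size (F (size (L j))))] =
  [seq rearrangement k | k <- iota 0 (size (L j))] ++ F (size (L j)).
Proof.
have Lj : (size (L j) <= size (L j.+1))%N by rewrite /= size_cat leq_addr.
rewrite (@map_rearrangement j.+1) /= ?size_cat ?leq_add2l ?leq_addr//.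
rewrite (@map_rearrangement j)// take_size takeD take_size_cat// drop_size_cat//.
by rewrite take_size_cat.
Qed.

End Rearrangement.

Section UnconditionalConvergence.
Context (R : realType) (V : normedModType R[i]).

(** If finite sums were unbounded, there would be finite sets [F n] arbitrarily far out with sums of
    norm above 1. A rearrangement that runs through such sets consecutively is not Cauchy. *)
Lemma unconditionally_cvg_bounded (v : nat -> V) : unconditionally_cvg v ->
  exists M : R, forall s : seq nat, uniq s -> rnorm (\sum_(k <- s) v k) <= M.
Proof.
move=> v_cvg; apply: contrapT => unbounded.
have far n : exists s : seq nat,
    [/\ uniq s, forall k, k \in s -> (n <= k)%N & 1 < rnorm (\sum_(k <- s) v k)].
  (* Discarding the indices below [n] costs at most the sum in [M], so more than 1 is left. *)
  pose M := 1 + \sum_(k < n) rnorm (v k).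
  have [s s_uniq sM] : exists2 s, uniq s & M < rnorm (\sum_(k <- s) v k).
    apply: contrapT => bounded; apply: unbounded; exists M => s s_uniq.
    by rewrite leNgt; apply/negP => sM; apply: bounded; exists s.
  exists [seq k <- s | (n <= k)%N]; split; first exact: filter_uniq.
    by move=> k; rewrite mem_filter => /andP[].
  rewrite -(ltrD2r (\sum_(k < n) rnorm (v k))) (lt_le_trans sM)//.
  rewrite (bigID (fun k => (n <= k)%N)) /= (le_trans (rnormD _ _))//.
  rewrite big_filter lerD2l (le_trans (rnorm_sum _ _ _))//.
  rewrite -[leLHS]big_filter.
  rewrite (@perm_big _ _ _ _ _ [seq k <- iota 0 n | k \in s]); last first.
    apply: uniq_perm; rewrite ?filter_uniq ?iota_uniq// => k.
    by rewrite !mem_filter mem_iota -ltnNge andbC.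
  rewrite big_filter -[leRHS](big_mkord xpredT (fun k => rnorm (v k))).
  rewrite /index_iota subn0 big_mkcond; apply: ler_sum => k _.
  by case: ifP => // _; exact: rnorm_ge0.
have /choice[F F_far] := far.
have F_uniq n : uniq (F n) by have [] := F_far n.
have F_ge n k : k \in F n -> (n <= k)%N by have [_ + _] := F_far n; apply.
have := v_cvg _ (rearrangement_bijective F_uniq F_ge).
(* The partial sums just before and just after the block [F n] are both within 1/2 of the limit,
   which forces the block to have norm below 1. *)
move=> /cvg_ex[l /cvgrPdist_lt/(_ 2^-1)].
rewrite invr_gt0 ltr0n => /(_ isT)[N _ NP].
pose n := size (prefix_of_rearrangement F N).
have Nn : (N <= n)%N by exact: prefix_size.
have partial_sum m : series (v \o rearrangement F) m =
    \sum_(k <- [seq rearrangement F k | k <- iota 0 m]) v k.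
  by rewrite /series /= big_map /index_iota subn0.
have [_ _] := F_far n; apply/negP; rewrite -leNgt.
have := NP _ Nn; have := NP (n + size (F n))%N (leq_trans Nn (leq_addr _ _)).
rewrite !partial_sum rearrangement_block// -/n big_cat /=.
set a := \sum_(k <- [seq _ | _ <- _]) v k; set b := \sum_(k <- F n) v k => ab a1.
rewrite -lecR -rnormE (_ : b = (l - a) - (l - (a + b))).
  rewrite (le_trans (ler_normB _ _))// ltW// (lt_le_trans (ltrD a1 ab))//.
  by rewrite -[2^-1]div1r -splitr.
by rewrite opprB addrC subrKA addrC addKr.
Qed.

End UnconditionalConvergence.

(** The nonnegative and the negative terms each form a finite sum to which the hypothesis
    applies. *)
Lemma sum_abs_le_finite_sums (R : realType) (g : nat -> R) (B : R) :
  (forall s : seq nat, uniq s -> `|\sum_(k <- s) g k| <= B) ->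
  forall n, \sum_(k < n) `|g k| <= 2 * B.
Proof.
move=> gB n; rewrite -(big_mkord xpredT (fun k => `|g k|)).
rewrite (bigID (fun k => 0 <= g k)) /=.
have part (P : pred nat) : `|\sum_(0 <= k < n | P k) g k| <= B.
  by rewrite -big_filter gB// filter_uniq ?iota_uniq.
have -> : \sum_(0 <= k < n | 0 <= g k) `|g k| = \sum_(0 <= k < n | 0 <= g k) g k.
  by apply: eq_bigr => k k_ge0; rewrite ger0_norm.
have -> : \sum_(0 <= k < n | ~~ (0 <= g k)) `|g k| =
    - \sum_(0 <= k < n | ~~ (0 <= g k)) g k.
  rewrite -sumrN; apply: eq_bigr => k; rewrite -ltNge => k_lt0.
  by rewrite ltr0_norm.
have := part (fun k => 0 <= g k); have := part (fun k => ~~ (0 <= g k)).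
rewrite !ler_norml => /andP[? ?] /andP[? ?]; lra.
Qed.

(** By Cauchy-Schwarz, all finite sums of the real and of the imaginary parts of [<w k, v>] are
    bounded by [M |v|]; each part contributes [2 M |v|]. *)
Lemma unconditionally_cvg_dot_bounded (R : realType) (H : normedModType R[i])
    (dot : {dot H for (@Num.conj R[i])})
    (dot_norm : forall u : H, dot u u = `|u| ^+ 2) (w : nat -> H) :
  unconditionally_cvg w ->
  exists M : R, forall v n,
    \sum_(k < n) modulus (dot (w k) v) <= M * rnorm v.
Proof.
move=> /unconditionally_cvg_bounded[M wM]; exists (4 * M) => v n.
have modulus_sum s : uniq s -> modulus (\sum_(k <- s) dot (w k) v) <= M * rnorm v.
  move=> s_uniq; rewrite -linear_sumlz.
  rewrite (le_trans (modulus_dot_le dot_norm _ _))// ler_wpM2r ?rnorm_ge0//.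
  exact: wM.
have Re_sum := @sum_abs_le_finite_sums _
  (fun k => complex.Re (dot (w k) v)) (M * rnorm v).
have Im_sum := @sum_abs_le_finite_sums _
  (fun k => complex.Im (dot (w k) v)) (M * rnorm v).
apply: (@le_trans _ _ (\sum_(k < n) `|complex.Re (dot (w k) v)| +
                       \sum_(k < n) `|complex.Im (dot (w k) v)|)).
  by rewrite -big_split; apply: ler_sum => k _; exact: modulus_le_ReIm.
rewrite (_ : 4 * M * rnorm v = 2 * (M * rnorm v) + 2 * (M * rnorm v)); last ring.
apply: lerD.
  apply: Re_sum => s s_uniq; apply: le_trans (modulus_sum s s_uniq).
  by rewrite -raddf_sum ler_norm_Re_modulus.
apply: Im_sum => s s_uniq; apply: le_trans (modulus_sum s s_uniq).
by rewrite -raddf_sum ler_norm_Im_modulus.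
Qed.

(** * The uniform boundedness principle, by nested balls *)

Section UniformBoundedness.
Context (R : realType) (H : completeNormedModType R[i]) (I : Type).
Variable q : I -> H -> R.
Hypothesis qD : forall i u v, q i (u + v) <= q i u + q i v.
Hypothesis qN : forall i u, q i (- u) = q i u.
Hypothesis qZ : forall i (a : R) u, 0 <= a -> q i (a%:C%C *: u) = a * q i u.
Hypothesis q_bounded : forall i, exists L, forall u, q i u <= L * rnorm u.
Hypothesis q_pointwise : forall u, exists M, forall i, q i u <= M.

(** The inductive step: every ball contains a smaller closed ball on which a single [q i] exceeds
    [M]. *)
Let shrink (M : R) (c : H) (r : R) : 0 < r ->
  ~ (exists C, forall i u, q i u <= C * rnorm u) ->
  exists c' r', [/\ 0 < r', r' <= r / 2, rnorm (c' - c) + r' <= r &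
    exists i, forall z, rnorm (z - c') <= r' -> M < q i z].
Proof.
move=> r_gt0 unbounded.
(* With this [C], rescaling [u] to norm [r / 2] gives a vector [w] with [q i w > |M| + 2]. *)
pose C := 2 * (`|M| + 2) / r.
have [i [u Cu]] : exists i u, C * rnorm u < q i u.
  apply: contrapT => bounded; apply: unbounded; exists C => i u.
  by rewrite leNgt; apply/negP => iu; apply: bounded; exists i, u.
have [L0 qL0] := q_bounded i; pose L := `|L0|.
have qL v : q i v <= L * rnorm v.
  by rewrite (le_trans (qL0 v))// ler_wpM2r ?rnorm_ge0 ?ler_norm.
have u_gt0 : 0 < rnorm u.
  rewrite lt_neqAle rnorm_ge0 andbT eq_sym; apply/eqP => u0.
  by have := qL u; rewrite leNgt u0 mulr0 -(mulr0 C) -u0 Cu.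
pose s := r / 2 / rnorm u.
have s_gt0 : 0 < s by rewrite !divr_gt0.
pose w := s%:C%C *: u.
have w_norm : rnorm w = r / 2.
  by rewrite rnormZ modulus_real ?(ltW s_gt0)// divfK// gt_eqF.
have w_q : `|M| + 2 < q i w.
  rewrite qZ ?(ltW s_gt0)//; have := Cu; rewrite -(ltr_pM2l s_gt0).
  rewrite (_ : s * (C * rnorm u) = `|M| + 2)// /s /C; field.
  by rewrite !gt_eqF.
(* Since [2 w = (c + w) - (c - w)], the larger of [q i (c + w)] and [q i (c - w)] is at least
   [q i w]. *)
have [c' c'_norm c'_q] : exists2 c', rnorm (c' - c) = r / 2 & `|M| + 2 < q i c'.
  have [|cw] := ltP (`|M| + 2) (q i (c + w)).
    by exists (c + w) => //; rewrite addrC addKr.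
  exists (c - w); first by rewrite addrC addKr rnormN.
  have : q i (2%:C%C *: w) <= q i (c + w) + q i (c - w).
    rewrite -[q i (c - w)]qN; apply: le_trans (qD _ _ _).
    rewrite (_ : _ *: w = c + w - (c - w))// opprB [w - c]addrC addrACA subrr add0r.
    by rewrite rmorph_nat scaler_nat mulr2n.
  by rewrite qZ//; lra.
have L1_gt0 : 0 < L + 1 by rewrite ltr_wpDl ?normr_ge0.
(* Radius [r / 2] keeps the new ball inside the old one; radius [1 / (L + 1)] lets [q i] drop by at
   most 1. *)
exists c', (Num.min (r / 2) (L + 1)^-1); split.
- by rewrite lt_min divr_gt0//= invr_gt0.
- by rewrite ge_min lexx.
- by rewrite c'_norm [leRHS](splitr r) lerD2l ge_min lexx.
exists i => z; rewrite le_min => /andP[_ zc'].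
have : q i c' <= q i z + L * rnorm (z - c').
  rewrite -{1}(subrK z c') addrC (le_trans (qD _ _ _))// lerD2l -opprB qN.
  exact: qL.
have : (L + 1) * rnorm (z - c') <= 1.
  by rewrite -ler_pdivlMl// mulr1.
have := rnorm_ge0 (z - c'); have := ler_norm M; lra.
Qed.

(** Otherwise nested balls shrink, by completeness, to a point [l] at which the values [q i l]
    exceed every natural number. *)
Lemma seminorm_uniform_boundedness : exists C, forall i u, q i u <= C * rnorm u.
Proof.
apply: contrapT => unbounded.
(* The condition on the radius stays inside the existential, so that choice yields a total function;
   a nonpositive radius gets an arbitrary value. *)
have step (nb : nat * (H * R)) : exists b : H * R, 0 < nb.2.2 ->
    [/\ 0 < b.2, b.2 <= nb.2.2 / 2, rnorm (b.1 - nb.2.1) + b.2 <= nb.2.2 &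
    exists i, forall z, rnorm (z - b.1) <= b.2 -> nb.1%:R < q i z].
  case: nb => n [c r] /=; have [r_gt0|_] := ltP 0 r; last by exists (c, r).
  by have [c' [r' h]] := shrink n%:R c r_gt0 unbounded; exists (c', r').
have [f f_step] := choice step.
pose fix ball_seq n := if n is m.+1 then f (m, ball_seq m) else (0, 1) : H * R.
pose c n := (ball_seq n).1; pose r n := (ball_seq n).2.
have r_gt0 n : 0 < r n.
  by elim: n => [|n IH]; rewrite /r//=; have [] := f_step (n, ball_seq n) IH.
have r_half n : r n.+1 <= r n / 2.
  by have [] := f_step (n, ball_seq n) (r_gt0 n).
have nested n m : (n <= m)%N -> rnorm (c m - c n) + r m <= r n.
  elim: m => [|m IH]; first by rewrite leqn0 => /eqP->; rewrite subrr rnorm0 add0r.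
  rewrite leq_eqVlt => /orP[/eqP->|/IH nm]; first by rewrite subrr rnorm0 add0r.
  have [_ _ + _] := f_step (m, ball_seq m) (r_gt0 m).
  rewrite /= -/(ball_seq m.+1) -/(c m.+1) -/(r m.+1) -/(c m) -/(r m) => mm.
  have := rnormD (c m.+1 - c m) (c m - c n); rewrite subrKA; lra.
have r_le n : r n <= n.+1%:R^-1.
  elim: n => [|n IH]; first by rewrite invr1.
  rewrite (le_trans (r_half n))// (le_trans (ler_wpM2r _ IH))// -invfM.
  by rewrite lef_pV2 ?posrE ?mulr_gt0// -natrM ler_nat mulSn addnC muln2 -addnn; lia.
have c_cvg : cvgn c.
  apply: cauchy_cvg; apply: cauchy_exP => e e_gt0.
  have eE : e = (complex.Re e)%:C%C by rewrite RRe_real// gtr0_real.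
  have Re_gt0 : 0 < complex.Re e by rewrite -ltcR -eE.
  pose n := Num.truncn (complex.Re e)^-1.
  have rn : r n < complex.Re e.
    rewrite (le_lt_trans (r_le n))// -[ltRHS]invrK ltf_pV2 ?posrE ?invr_gt0//.
    exact: truncnS_gt.
  exists (c n), n => // m /= nm; rewrite -ball_normE /ball_ /= eE rnormE ltcR.
  rewrite rnormB (le_lt_trans _ rn)// (le_trans _ (nested _ _ nm))//.
  by rewrite lerDl ltW.
have /cvg_ex[l /cvgrPdist_lt c_l] := c_cvg.
have l_in n : rnorm (l - c n) <= r n.
  apply/ler_addgt0Pr => e e_gt0.
  have [|N _ cN] := c_l e%:C%C; first by rewrite ltcR.
  have := cN _ (leq_maxl N n); rewrite /= rnormE ltcR => le.
  have := nested _ _ (leq_maxr N n); have := r_gt0 (maxn N n).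
  have := rnormD (l - c (maxn N n)) (c (maxn N n) - c n); rewrite subrKA; lra.
have [M qM] := q_pointwise l.
pose n := Num.truncn M.
have [_ _ _ [i qi]] := f_step (n.+1, ball_seq n.+1) (r_gt0 _).
have := qi l (l_in n.+2); have := qM i; have : M < n.+1%:R by exact: truncnS_gt.
rewrite /=; lra.
Qed.

End UniformBoundedness.

(** * Rescaling *)

Section Rescaling.
Context (R : realType) (H : completeNormedModType R[i]).
Context (dot : {dot H for (@Num.conj R[i])}).
Hypothesis dot_norm : forall u : H, dot u u = `|u| ^+ 2.
Variables (x y : nat -> H).

(** Uniform boundedness in [u] for the family indexed by [(v, n)]. Dividing by [|v|] makes the
    pointwise bound independent of [v]; for [v = 0] the quotient is 0 by convention, so that case is
    treated separately at the end. *)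
Lemma unconditional_bilinear_bound :
  (forall u : H, unconditionally_cvg (fun k => dot u (y k) *: x k)) ->
  exists2 C : R, 0 <= C & forall u v n,
    \sum_(k < n) modulus (dot u (y k)) * modulus (dot (x k) v) <=
      C * (rnorm u * rnorm v).
Proof.
move=> T_cvg.
pose q (i : H * nat) u :=
  (\sum_(k < i.2) modulus (dot u (y k)) * modulus (dot (x k) i.1)) / rnorm i.1.
have term_ge0 u v k : 0 <= modulus (dot u (y k)) * modulus (dot (x k) v).
  by rewrite mulr_ge0 ?modulus_ge0.
have [||||u|C qC] := @seminorm_uniform_boundedness _ _ _ q.
- move=> [v n] u u'; rewrite /q /= -mulrDl ler_wpM2r ?invr_ge0 ?rnorm_ge0//.
  rewrite -big_split; apply: ler_sum => k _ /=; rewrite -mulrDl linearDl.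
  by rewrite ler_wpM2r ?modulus_ge0 ?modulusD.
- move=> [v n] u; rewrite /q; congr (_ / _); apply: eq_bigr => k _.
  by rewrite linearNl modulusN.
- move=> [v n] a u a_ge0; rewrite /q /= mulrA mulr_sumr; congr (_ / _).
  apply: eq_bigr => k _.
  by rewrite linearZl_LR /= modulusM modulus_real// mulrA.
- move=> [v n].
  exists ((\sum_(k < n) rnorm (y k) * modulus (dot (x k) v)) / rnorm v) => u.
  rewrite /q /= mulrAC ler_wpM2r ?invr_ge0 ?rnorm_ge0// mulr_suml.
  apply: ler_sum => k _; rewrite mulrAC ler_wpM2r ?modulus_ge0// mulrC.
  exact: modulus_dot_le.
- have [M uM] := unconditionally_cvg_dot_bounded dot_norm (T_cvg u).
  exists `|M| => -[v n]; rewrite /q /=.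
  have [->|v_neq0] := eqVneq (rnorm v) 0; first by rewrite invr0 mulr0.
  have v_gt0 : 0 < rnorm v by rewrite lt_neqAle eq_sym v_neq0 rnorm_ge0.
  rewrite ler_pdivrMr// (le_trans _ (ler_wpM2r (ltW v_gt0) (ler_norm M)))//.
  apply: le_trans (uM v n); apply: ler_sum => k _.
  by rewrite linearZl_LR /= modulusM.
exists `|C| => // u v n.
have [v0|v_neq0] := eqVneq (rnorm v) 0.
  rewrite v0 !mulr0 big1// => k _; apply/eqP; rewrite mulf_eq0.
  have : modulus (dot (x k) v) <= rnorm (x k) * rnorm v by exact: modulus_dot_le.
  by rewrite v0 mulr0 orbC => h; rewrite eq_le h modulus_ge0.
have v_gt0 : 0 < rnorm v by rewrite lt_neqAle eq_sym v_neq0 rnorm_ge0.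
have := qC (v, n) u; rewrite /q /= ler_pdivrMr// => /le_trans; apply.
by rewrite mulrA !ler_wpM2r ?rnorm_ge0// ler_norm.
Qed.

Variable C : R.
Hypothesis C_ge0 : 0 <= C.
Hypothesis C_bound : forall u v n,
  \sum_(k < n) modulus (dot u (y k)) * modulus (dot (x k) v) <=
    C * (rnorm u * rnorm v).

(** Khintchine in both factors costs [2 * 2 = 4]. The signs in the two sums are independent, so the
    product of means is an iterated mean, to which [C_bound] applies pointwise. *)
Lemma square_function_bound (lu lv : seq H) n :
  \sum_(k < n) Num.sqrt (\sum_(a <- lu) modulus (dot a (x k)) ^+ 2) *
               Num.sqrt (\sum_(a <- lv) modulus (dot a (y k)) ^+ 2) <=
    2 * C * (\sum_(a <- lu) rnorm a ^+ 2 + \sum_(a <- lv) rnorm a ^+ 2).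
Proof.
apply: (@le_trans _ _ (4 * rademacher lu (fun s => rademacher lv (fun s' =>
    \sum_(k < n) modulus (dot s' (y k)) * modulus (dot (x k) s))))).
  have -> : rademacher lu (fun s => rademacher lv (fun s' =>
      \sum_(k < n) modulus (dot s' (y k)) * modulus (dot (x k) s))) =
    \sum_(k < n) rademacher lu (fun s => modulus (dot s (x k))) *
                 rademacher lv (fun s' => modulus (dot s' (y k))).
    under eq_bigr do rewrite mulrC -rademacherZ.
    rewrite -rademacher_sum; apply: eq_rademacher => s.
    rewrite rademacher_sum; apply: eq_bigr => k _.
    rewrite mulrC -rademacherZ; apply: eq_rademacher => s'.
    by rewrite mulrC (modulus_dotC _ s).
  rewrite mulr_sumr; apply: ler_sum => k _.
  have := ler_pM (sqrtr_ge0 _) (sqrtr_ge0 _) (khintchine_dot dot lu (x k))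
    (khintchine_dot dot lv (y k)).
  by move/le_trans; apply; rewrite le_eqVlt; apply/orP; left; apply/eqP; ring.
(* Here [|s| |s'| <= (|s|^2 + |s'|^2) / 2] separates the two means, which are then known exactly. *)
apply: (@le_trans _ _ (4 * rademacher lu (fun s => rademacher lv (fun s' =>
    C / 2 * (rnorm s ^+ 2 + rnorm s' ^+ 2))))).
  rewrite ler_pM2l//; apply: rademacher_le => s; apply: rademacher_le => s'.
  apply: le_trans (C_bound _ _ _) _; rewrite -mulrA ler_wpM2l//.
  have := sqr_ge0 (rnorm s - rnorm s'); nra.
rewrite (@eq_rademacher _ _ _ _ (fun s => C / 2 * (rnorm s ^+ 2 +
    \sum_(a <- lv) rnorm a ^+ 2))).
  rewrite rademacherZ rademacherD rademacher_cst (rademacher_rnorm dot_norm).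
  by rewrite mulrA le_eqVlt; apply/orP; left; apply/eqP; field.
move=> s; rewrite rademacherZ rademacherD rademacher_cst.
by rewrite (rademacher_rnorm dot_norm).
Qed.

Lemma rescaling : exists t : nat -> R, forall u v n,
  \sum_(k < n) (modulus (dot u (x k)) ^+ 2 * expR (t k) +
                modulus (dot v (y k)) ^+ 2 * expR (- t k)) <=
  (4 * C + 2) * (rnorm u ^+ 2 + rnorm v ^+ 2).
Proof.
pose c (i : H * H * nat) := rnorm i.1.1 ^+ 2 + rnorm i.1.2 ^+ 2.
pose a (i : H * H * nat) k := modulus (dot i.1.1 (x k)) ^+ 2.
pose b (i : H * H * nat) k := modulus (dot i.1.2 (y k)) ^+ 2.
have sqr_dot_le u z : modulus (dot u z) ^+ 2 <= rnorm z ^+ 2 * rnorm u ^+ 2.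
  rewrite -exprMn lerXn2r ?nnegrE ?mulr_ge0 ?modulus_ge0 ?rnorm_ge0//.
  by rewrite mulrC modulus_dot_le.
have [|||||r p n p_ge0|t tF] := @balanced_weights R (H * H * nat)%type snd a b c
  (fun k => rnorm (x k) ^+ 2) (fun k => rnorm (y k) ^+ 2) (2 * C).
- move=> [[u v] n] k; rewrite sqr_ge0 /= (le_trans (sqr_dot_le _ _))//.
  by rewrite ler_wpM2l ?sqr_ge0// lerDl sqr_ge0.
- move=> [[u v] n] k; rewrite sqr_ge0 /= (le_trans (sqr_dot_le _ _))//.
  by rewrite ler_wpM2l ?sqr_ge0// lerDr sqr_ge0.
- by move=> k; exact: sqr_ge0.
- by move=> k; exact: sqr_ge0.
- by move=> i; rewrite addr_ge0 ?sqr_ge0.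
(* Scaling the vectors by [sqrt (p i)] absorbs the weights, so the unweighted bound covers every
   combination. *)
- pose scale f := [seq (Num.sqrt (p i))%:C%C *: (f i : H) | i <- r].
  have scaleE f (g : H -> R) : (forall s z, 0 <= s -> g (s%:C%C *: z) = s * g z) ->
      \sum_(z <- scale f) g z ^+ 2 = \sum_(i <- r) p i * g (f i) ^+ 2.
    move=> gZ; rewrite big_map; apply: eq_bigr => i _.
    by rewrite gZ ?sqrtr_ge0// exprMn sqr_sqrtr.
  have dotZ z s u : 0 <= s ->
      modulus (dot (s%:C%C *: u) z) = s * modulus (dot u z).
    by move=> s_ge0; rewrite linearZl_LR /= modulusM modulus_real.
  have normZ s (u : H) : 0 <= s -> rnorm (s%:C%C *: u) = s * rnorm u.
    by move=> s_ge0; rewrite rnormZ modulus_real.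
  have := square_function_bound (scale (fun i => i.1.1)) (scale (fun i => i.1.2)) n.
  rewrite !(scaleE _ _ normZ) -big_split /=.
  under [X in _ <= _ * X -> _]eq_bigr do rewrite -mulrDr.
  apply: le_trans; apply: ler_sum => k _.
  rewrite !(scaleE _ _ (dotZ _)) sqrtrM//.
  by apply: sumr_ge0 => i _; rewrite mulr_ge0 ?sqr_ge0.
exists t => u v n; have := tF (u, v, n); rewrite /a /b /c /= => /le_trans; apply.
by rewrite mulrA -natrM.
Qed.

End Rescaling.

Lemma Bessel_with_partial_sums (R : realType) (H : normedModType R[i])
    (dot : H -> H -> R[i]) (C : R) (z : nat -> H) :
  (forall u n, \sum_(k < n) modulus (dot u (z k)) ^+ 2 <= C * rnorm u ^+ 2) ->
  Bessel_with dot C z.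
Proof.
move=> zC u; apply: lime_le.
  by apply: is_cvg_nneseries => k _ _; rewrite lee_fin sqr_ge0.
by apply: nearW => n; rewrite big_mkord sumEFin lee_fin zC.
Qed.

Theorem theorem1p2 (R : realType) (H : completeNormedModType R[i])
    (dot : {dot H for (@Num.conj R[i])})
    (dot_norm : forall u : H, dot u u = `|u| ^+ 2)
    (H_separable : separable H)
    (x y : nat -> H)
    (T_cvg : forall u : H, unconditionally_cvg (fun k => dot u (y k) *: x k)) :
  exists alpha : nat -> R[i],
    [/\ forall k, alpha k != 0,
        Bessel dot (fun k => alpha k *: x k)
      & Bessel dot (fun k => ((alpha k)^*)^-1 *: y k)].
Proof.
have [C C_ge0 C_bound] := unconditional_bilinear_bound dot_norm T_cvg.
have [t tC] := rescaling dot_norm C_ge0 C_bound.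
have C2_gt0 : 0 < 4 * C + 2 by lra.
have modulus_exp s : modulus (expR (s / 2))%:C%C ^+ 2 = expR s.
  by rewrite modulus_real ?expR_ge0// -expRM_natl mulrC divfK.
exists (fun k => (expR (t k / 2))%:C%C); split.
- by move=> k; rewrite (inj_eq (@complexI R)) gt_eqF// expR_gt0.
- exists (4 * C + 2) => //; apply: Bessel_with_partial_sums => u n.
  (* Setting one of the two vectors to 0, here the second and below the first, isolates each Bessel
     bound. *)
  have := tC u 0 n; rewrite rnorm0 expr0n addr0; apply: le_trans.
  apply: ler_sum => k _; rewrite linearZr_LR /= modulusM modulusJ exprMn.
  by rewrite modulus_exp linear0l modulus0 expr0n mul0r addr0 mulrC.
- exists (4 * C + 2) => //; apply: Bessel_with_partial_sums => u n.
  have := tC 0 u n; rewrite rnorm0 expr0n add0r; apply: le_trans.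
  apply: ler_sum => k _.
  rewrite linear0l modulus0 expr0n mul0r add0r linearZr_LR /= modulusM modulusJ.
  by rewrite modulusV modulusJ exprMn exprVn modulus_exp expRN mulrC.
Qed.
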